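(* Let $c=\texttt{024130124023013024134124023413024134124023013024}$ (a word of length 48), and let $m$ be the 95-uniform morphism on $\{\texttt{0},\texttt{1},\texttt{2},\texttt{3},\texttt{4}\}^*$ defined by \begin{align*} m(\texttt{0})&=c\,\texttt{13012402301302402301240241341240230130240230124},\\ m(\texttt{1})&=c\,\texttt{02301240241301240230130240234124024134124023013},\\ m(\texttt{2})&=c\,\texttt{02341240241301240234130241301240230130240230124},\\ m(\texttt{3})&=c\,\texttt{13012402301302402301240241341240230130240234124},\\ m(\texttt{4})&=c\,\texttt{02341240241301240230130240234124024134124023013}. \end{align*} Then the infinite word $m^\omega(\texttt{0})$ over the 5-letter alphabet $\{\texttt{0},\texttt{1},\texttt{2},\texttt{3},\texttt{4}\}$ avoids half-flips: there are no non-empty finite words $u,v$ with $|u|=|v|$ such that both $uv$ and $vu$ are factors of $m^\omega(\texttt{0})$.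
   Context: A factor of a word is a finite block of consecutive letters of it. A morphism on a free monoid is $q$-uniform if the image of every letter has length $q$. Since $m(\texttt{0})$ begins with $\texttt{0}$, each $m^n(\texttt{0})$ is a prefix of $m^{n+1}(\texttt{0})$, and $m^\omega(\texttt{0})$ denotes the unique right-infinite word having every $m^n(\texttt{0})$, $n\geq 0$, as a prefix (the fixed point of $m$ starting with $\texttt{0}$). A word contains a half-flip if there are non-empty finite words $u,v$ with $|u|=|v|$ such that both $uv$ and $vu$ are factors of it; the occurrences may be anywhere and may overlap or coincide, and $u=v$ is allowed. *)

(* Defs.v *)
From mathcomp Require Import all_boot.

Set Implicit Arguments.
Unset Strict Implicit.
Unset Printing Implicit Defensive.

Section Words.

Variable A : eqType.

(* Finite words are [seq A]; right-infinite words are functions [nat -> A],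
   with positions numbered from 0. *)
Implicit Types (w x : nat -> A) (u v s : seq A).

Definition is_prefix s w : Prop := s = mkseq w (size s).

Definition factor s w : Prop :=
  exists i, s = mkseq (fun j => w (i + j)) (size s).

Definition contains_half_flip w : Prop :=
  exists u v, [/\ u <> [::], v <> [::], size u = size v,
                 factor (u ++ v) w & factor (v ++ u) w].

(* A morphism of the free monoid on A is determined by the images h of the
   letters; this is its value on a word. *)
Definition morph (h : A -> seq A) s : seq A := flatten (map h s).

Definition uniform q (h : A -> seq A) : Prop := forall a, size (h a) = q.

(* The letter of h^omega(a) at position i is read off h^(i+1)(a), which has
   length q^(i+1) > i when h is q-uniform with q > 1.  If moreover h a begins
   with a, the result is the unique infinite word having every h^n(a) as a
   prefix: see [omega_word_prefix] and [omega_word_unique]. *)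
Definition omega_word (h : A -> seq A) (a : A) : nat -> A :=
  fun i => nth a (iter i.+1 (morph h) [:: a]) i.

Lemma size_morph q h s : uniform q h -> size (morph h s) = q * size s.
Proof.
move=> hq; elim: s => [|b s IHs]; first by rewrite muln0.
by rewrite /morph /= size_cat hq mulnS -IHs.
Qed.

Lemma size_iter_morph q h a n :
  uniform q h -> size (iter n (morph h) [:: a]) = q ^ n.
Proof.
move=> hq; elim: n => // n IHn.
by rewrite iterS (size_morph _ hq) IHn expnS.
Qed.

Lemma iter_morph_prefix h a n k :
  prefix [:: a] (h a) ->
  prefix (iter n (morph h) [:: a]) (iter (k + n) (morph h) [:: a]).
Proof.
move=> ha; elim: k => [|k IHk]; first exact: prefix_refl.
apply: (prefix_trans IHk); rewrite addSn; elim: (k + n) => [|p IHp].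
  by rewrite /morph /= cats0.
rewrite iterS [X in prefix _ X]iterS; case/prefixP: IHp => s ->.
by rewrite /morph map_cat flatten_cat prefix_prefix.
Qed.

Lemma omega_word_prefix q h a n :
  1 < q -> uniform q h -> prefix [:: a] (h a) ->
  is_prefix (iter n (morph h) [:: a]) (omega_word h a).
Proof.
move=> q1 hq ha; apply: (@eq_from_nth _ a); first by rewrite size_mkseq.
move=> i lt_i; rewrite nth_mkseq // /omega_word.
have lt_i' : i < size (iter i.+1 (morph h) [:: a]).
  by rewrite (size_iter_morph _ _ hq) (ltn_trans (ltnSn i)) // ltn_expl.
have /prefixP[s1 e1] := iter_morph_prefix n i.+1 ha.
have /prefixP[s2 e2] := iter_morph_prefix i.+1 n ha.
have := congr1 (nth a ^~ i) e1; rewrite nth_cat lt_i => <-.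
by rewrite addnC e2 nth_cat lt_i'.
Qed.

Lemma omega_word_unique q h a w :
  1 < q -> uniform q h ->
  (forall n, is_prefix (iter n (morph h) [:: a]) w) ->
  w =1 omega_word h a.
Proof.
move=> q1 hq hw i; rewrite /omega_word (hw i.+1) nth_mkseq //.
by rewrite (size_iter_morph _ _ hq) (ltn_trans (ltnSn i)) // ltn_expl.
Qed.

End Words.

Declare Scope letter_scope.
Delimit Scope letter_scope with letter.
Notation "0" := (@Ordinal 5 0 isT) : letter_scope.
Notation "1" := (@Ordinal 5 1 isT) : letter_scope.
Notation "2" := (@Ordinal 5 2 isT) : letter_scope.
Notation "3" := (@Ordinal 5 3 isT) : letter_scope.
Notation "4" := (@Ordinal 5 4 isT) : letter_scope.

Definition c : seq 'I_5 :=
  ([:: 0; 2; 4; 1; 3; 0; 1; 2; 4; 0; 2; 3; 0; 1; 3; 0; 2; 4; 1; 3;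
      4; 1; 2; 4; 0; 2; 3; 4; 1; 3; 0; 2; 4; 1; 3; 4; 1; 2; 4; 0; 2;
      3; 0; 1; 3; 0; 2; 4])%letter.

Definition m (a : 'I_5) : seq 'I_5 :=
  match val a with
  | 0 => c ++
     ([:: 1; 3; 0; 1; 2; 4; 0; 2; 3; 0; 1; 3; 0; 2; 4; 0; 2; 3; 0; 1;
      2; 4; 0; 2; 4; 1; 3; 4; 1; 2; 4; 0; 2; 3; 0; 1; 3; 0; 2; 4; 0;
      2; 3; 0; 1; 2; 4])%letter
  | 1 => c ++
     ([:: 0; 2; 3; 0; 1; 2; 4; 0; 2; 4; 1; 3; 0; 1; 2; 4; 0; 2; 3; 0;
      1; 3; 0; 2; 4; 0; 2; 3; 4; 1; 2; 4; 0; 2; 4; 1; 3; 4; 1; 2; 4;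
      0; 2; 3; 0; 1; 3])%letter
  | 2 => c ++
     ([:: 0; 2; 3; 4; 1; 2; 4; 0; 2; 4; 1; 3; 0; 1; 2; 4; 0; 2; 3; 4;
      1; 3; 0; 2; 4; 1; 3; 0; 1; 2; 4; 0; 2; 3; 0; 1; 3; 0; 2; 4; 0;
      2; 3; 0; 1; 2; 4])%letter
  | 3 => c ++
     ([:: 1; 3; 0; 1; 2; 4; 0; 2; 3; 0; 1; 3; 0; 2; 4; 0; 2; 3; 0; 1;
      2; 4; 0; 2; 4; 1; 3; 4; 1; 2; 4; 0; 2; 3; 0; 1; 3; 0; 2; 4; 0;
      2; 3; 4; 1; 2; 4])%letter
  | _ => c ++
     ([:: 0; 2; 3; 4; 1; 2; 4; 0; 2; 4; 1; 3; 0; 1; 2; 4; 0; 2; 3; 0;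
      1; 3; 0; 2; 4; 0; 2; 3; 4; 1; 2; 4; 0; 2; 4; 1; 3; 4; 1; 2; 4;
      0; 2; 3; 0; 1; 3])%letter
  end.

Lemma size_c : size c = 48.
Proof. by []. Qed.

Lemma m_uniform : uniform 95 m.
Proof. by case=> [[|[|[|[|[]]]]]]. Qed.

Lemma m_prolongable : prefix [:: 0%letter] (m 0%letter).
Proof. by []. Qed.

(* Main.v *)
(* Two equal factors of length 44 occur at positions that are congruent mod 95.
   Hence a half-flip uv, vu of length n >= 44 forces 2n = 0 mod 95, so n = 95k,
   and both factors are cut by the images of m at the same place.  Comparing the
   images gives two factors of length 2k + 1 of the fixed point that form a
   half-flip of length k, except possibly at their first, middle and last
   letters.  Either m determines these letters on one side of the cut, and
   the word contains a half-flip of length k, or the six letters are "twisted".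
   For k <= 44 the twisted case is excluded by inspecting the short factors; for
   k >= 45, synchronization applies once more and puts the six letters in one
   column of the table of m, where no twisted letters occur.  Half-flips of length
   less than 44 are excluded by inspection. *)
Require Import Defs.
From mathcomp Require Import all_boot.
From mathcomp Require Import zify.

Set Implicit Arguments.
Unset Strict Implicit.
Unset Printing Implicit Defensive.

(** * Enumerated factors and the finite tests on them *)

Definition images : seq (seq nat) :=
  [seq map val (m a) | a <- [:: 0; 1; 2; 3; 4]%letter].

Definition img (a : nat) : seq nat := nth [::] images a.

Definition w (i : nat) : nat := val (omega_word m 0%letter i).

Definition factor_pairs : seq (nat * nat) :=
  [:: (0, 1); (0, 2); (1, 2); (1, 3); (2, 3);
      (2, 4); (3, 0); (3, 4); (4, 0); (4, 1)].

(* 89 = 2 * 44 + 1 is the longest factor length that is inspected. *)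
Definition windows : seq (nat * seq nat) :=
  [seq (r, take 89 (drop r (img p.1 ++ img p.2)))
     | p <- factor_pairs, r <- iota 0 95].

Definition strip (T : Type) (a : nat) (A : seq (T * seq nat)) :=
  pmap (fun x => if x.2 is b :: s then
                   if eqn a b then Some (x.1, s) else None
                 else None) A.

(* Descends the trie of the words of A and B, all of length d, so that rel is
   evaluated only on the tags of equal words. *)
Fixpoint compat T (rel : T -> T -> bool) d (A B : seq (T * seq nat)) :=
  if A is [::] then true else
  if B is [::] then true else
  if d is d'.+1 then
    all (fun a => @compat T rel d' (strip a A) (strip a B)) [:: 0; 1; 2; 3; 4]
  else all (fun x => all (fun y => rel x.1 y.1) B) A.

(** Reading two halves in parallel lets a mismatch in either one prune the trie early. *)
Definition interleave (u v : seq nat) : seq nat :=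
  flatten [seq [:: p.1; p.2] | p <- zip u v].

Definition block o n (s : seq nat) := take n (drop o s).

Definition sync_words := [seq (x.1, block 0 44 x.2) | x <- windows].

Definition flip_words n :=
  [seq (tt, interleave (block 0 n x.2) (block n n x.2)) | x <- windows].

Definition flipped_words n :=
  [seq (tt, interleave (block n n x.2) (block 0 n x.2)) | x <- windows].

Definition pair_of x y a b := eqn a x && eqn b y || eqn a y && eqn b x.

(* Pairs of letters whose images under m may agree after, respectively before,
   a cut at position r, with e := (r <= 67); this is relevant for 51 < r < 92 only,
   since otherwise one side of the cut determines the letter. *)
Definition suffix_twins e a b :=
  [|| eqn a b, pair_of 1 4 a b | ~~ e && pair_of 0 2 a b].

Definition prefix_twins e a b :=
  [|| eqn a b, pair_of 0 3 a b | e && pair_of 2 4 a b].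

(** The obstruction to descent: the cut images are compatible, yet neither the left nor the right
    choice of letters completes a shorter half-flip. *)
Definition twisted e (x y : nat * nat * nat) :=
  let: (a0, a1, a2) := x in
  let: (b0, b1, b2) := y in
  [&& suffix_twins e a0 b1, suffix_twins e a1 b0,
      prefix_twins e a1 b2, prefix_twins e a2 b1,
      ~~ (eqn a0 b1 && eqn a1 b0) & ~~ (eqn a1 b2 && eqn a2 b1)].

(** Both values of [e] are excluded, since the cut position one level up is not visible here. *)
Definition untwisted x y := ~~ twisted true x y && ~~ twisted false x y.

Definition ends k (s : seq nat) := (nth 0 s 0, nth 0 s k, nth 0 s k.*2).

Definition near_flip_words k :=
  [seq (ends k x.2, interleave (block 1 k.-1 x.2) (block k.+1 k.-1 x.2))
     | x <- windows].

Definition near_flipped_words k :=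
  [seq (ends k x.2, interleave (block k.+1 k.-1 x.2) (block 1 k.-1 x.2))
     | x <- windows].

Definition triples (s : seq nat) :=
  [seq (p, z) | p <- [seq (x, y) | x <- s, y <- s], z <- s].

Definition column r := undup [seq nth 0 u r | u <- images].

Definition letter_pairs := [seq (a, b) | a <- iota 0 5, b <- iota 0 5].

(** The threshold 67 is the length of the longest common prefix of the images of 2 and 4. *)
Definition cut_test r :=
  let sfx p := drop r (img p.1) == drop r (img p.2) in
  let pfx p := take r (img p.1) == take r (img p.2) in
  let twins e p := (sfx p ==> suffix_twins e p.1 p.2) &&
                   (pfx p ==> prefix_twins e p.1 p.2) in
  [|| all (fun p => sfx p ==> (p.1 == p.2)) letter_pairs,
      all (fun p => pfx p ==> (p.1 == p.2)) letter_pairs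
    | all (twins (r <= 67)) letter_pairs].

Lemma sync_test : compat eqn 44 sync_words sync_words.
Proof. by vm_compute. Qed.

(** With the constant relation [false], [compat] asserts that the two lists share no word. *)
Lemma flip_test :
  all (fun n => compat (fun _ _ => false) n.*2 (flip_words n) (flipped_words n))
    (iota 1 43).
Proof. by vm_compute. Qed.

Lemma near_flip_test :
  all (fun k => compat untwisted k.-1.*2 (near_flip_words k) (near_flipped_words k))
    (iota 1 44).
Proof. by vm_compute. Qed.

Lemma column_test :
  all (fun r => all (fun x => all (untwisted x) (triples (column r)))
                    (triples (column r))) (iota 0 95).
Proof. by vm_compute. Qed.

Lemma cut_testT : all cut_test (iota 1 94).
Proof. by vm_compute. Qed.

(** * Uniform morphisms acting on their fixed points *)

Section UniformFixedPoint.

Variables (A : eqType) (q : nat) (h : A -> seq A) (a : A).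
Hypotheses (q_gt1 : 1 < q) (hq : uniform q h) (ha : prefix [:: a] (h a)).

(** The prefix of length [q ^ n] is sent to that of length [q ^ n.+1]; since [n < q ^ n], truncation
    gives the claim. *)
Lemma morph_mkseq n :
  morph h (mkseq (omega_word h a) n) = mkseq (omega_word h a) (q * n).
Proof.
have pre k := omega_word_prefix k q_gt1 hq ha.
have := pre n.+1; have := pre n; rewrite /is_prefix iterS.
rewrite !(size_morph _ hq) !(size_iter_morph _ _ hq).
have [k ->] : exists k, q ^ n = n + k.
  by exists (q ^ n - n); rewrite subnKC // ltnW // ltn_expl.
set s := iter _ _ _ => ->.
rewrite /mkseq mulnDr !iotaD !map_cat /morph map_cat flatten_cat.
move/(congr1 (take (q * n))); rewrite !take_cat.
have -> : size (flatten (map h (map (omega_word h a) (iota 0 n)))) = q * n.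
  by rewrite (size_morph _ hq) size_map size_iota.
by rewrite size_map size_iota !ltnn subnn !take0 !cats0.
Qed.

Lemma omega_word_block i r :
  r < q -> omega_word h a (q * i + r) = nth a (h (omega_word h a i)) r.
Proof.
move=> rq; have := morph_mkseq i.+1.
move/(congr1 (nth a ^~ (q * i + r))).
rewrite nth_mkseq; last by rewrite mulnS addnC ltn_add2r.
move=> <-; rewrite -[i.+1]addn1 /mkseq iotaD map_cat /morph map_cat flatten_cat.
rewrite nth_cat (size_morph _ hq) size_map size_iota.
by rewrite ltnNge leq_addr /= addKn /= cats0.
Qed.

End UniformFixedPoint.

(** * The fixed point as a word over numbers, and its short factors *)

Lemma img_val (a : 'I_5) : img a = map val (m a).
Proof. by case: a => [[|[|[|[|[]]]]]] //. Qed.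

Lemma w_lt5 i : w i < 5.
Proof. exact: ltn_ord. Qed.

Lemma size_img a : a < 5 -> size (img a) = 95.
Proof. by do 5 case: a => [|a] //. Qed.

Lemma w_block p i r : r < 95 -> p = 95 * i + r -> w p = nth 0 (img (w i)) r.
Proof.
move=> r95 ->; rewrite /w img_val.
rewrite (omega_word_block _ m_uniform m_prolongable) //.
by rewrite (nth_map 0%letter) // m_uniform.
Qed.

(** Adjacent letters lie inside one image or across a border; all five images and all 25 borders are
    checked. *)
Lemma w_pair i : (w i, w i.+1) \in factor_pairs.
Proof.
pose inner a := all (fun r => (nth 0 (img a) r, nth 0 (img a) r.+1)
                             \in factor_pairs) (iota 0 94).
have inner_test : all inner (iota 0 5) by vm_compute.
have outer_test : all (fun a => all (fun b =>
    (nth 0 (img a) 94, nth 0 (img b) 0) \in factor_pairs) (iota 0 5)) (iota 0 5).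
  by vm_compute.
have r95 := ltn_pmod i (isT : 0 < 95); have ei := divn_eq i 95.
rewrite mulnC in ei; move: (i %/ 95) (i %% 95) r95 ei => q r r95 ei.
rewrite (w_block r95 ei); case: (ltnP r 94) => r94.
  have ei1 : i.+1 = 95 * q + r.+1 by rewrite ei addnS.
  rewrite (w_block (r94 : r.+1 < 95) ei1).
  have/allP/(_ (w q)) := inner_test.
  rewrite mem_iota w_lt5 => /(_ isT)/allP; apply.
  by rewrite mem_iota.
have {r95 r94} er : r = 94 by lia.
rewrite er in ei *.
have ei1 : i.+1 = 95 * q.+1 + 0 by lia.
rewrite (w_block (isT : 0 < 95) ei1).
have/allP/(_ (w q)) := outer_test.
rewrite mem_iota w_lt5 => /(_ isT)/allP; apply.
by rewrite mem_iota w_lt5.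
Qed.

(** As 89 < 95, a window starting in one image ends at the latest in the next. *)
Lemma windowP p : (p %% 95, mkseq (fun t => w (p + t)) 89) \in windows.
Proof.
have r95 := ltn_pmod p (isT : 0 < 95); have ep := divn_eq p 95.
rewrite mulnC in ep; move: (p %/ 95) (p %% 95) r95 ep => q r r95 ep.
apply/allpairsP; exists ((w q, w q.+1), r); split; first exact: w_pair.
  by rewrite mem_iota.
congr (_, _); cbn [fst snd].
have s1 := size_img (w_lt5 q); have s2 := size_img (w_lt5 q.+1).
have st : size (take 89 (drop r (img (w q) ++ img (w q.+1)))) = 89.
  by rewrite size_takel // size_drop size_cat s1 s2; lia.
apply: (@eq_from_nth _ 0); rewrite size_mkseq ?st // => t t89.
rewrite nth_mkseq // nth_take // nth_drop nth_cat s1; case: ltnP => h.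
  by apply: w_block; lia.
by apply: w_block; lia.
Qed.

(** * Soundness of the trie comparison *)

Section Compat.

Variables (T : eqType) (rel : T -> T -> bool).

Lemma mem_strip (A : seq (T * seq nat)) x a s :
  (x, a :: s) \in A -> (x, s) \in strip a A.
Proof.
move=> xA; rewrite mem_pmap; apply/mapP; exists (x, a :: s) => //=.
by have -> : eqn a a by apply/eqnP.
Qed.

(** The induction follows the branch spelled by [s]; its letters are below 5 because [compat]
    branches only over those. *)
Lemma compatP d (A B : seq (T * seq nat)) x y s :
  compat rel d A B -> (x, s) \in A -> (y, s) \in B ->
  size s = d -> all (gtn 5) s -> rel x y.
Proof.
elim: d A B s => [|d IHd] [|x0 A] [|y0 B] s //.
  by move=> /allP h xA yB _ _; have /allP/(_ _ yB) := h _ xA.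
case: s => // a s h xA yB [sd] /= /andP[a5 s5].
have {h} : all (fun b => compat rel d (strip b (x0 :: A)) (strip b (y0 :: B))) (iota 0 5).
  exact: h.
move/allP/(_ a); rewrite mem_iota => /(_ a5) h.
exact: (IHd _ _ _ h (mem_strip xA) (mem_strip yB)).
Qed.

End Compat.

Lemma size_interleave u v : size u = size v -> size (interleave u v) = (size u).*2.
Proof.
elim: u v => [|a u IHu] [|b v] //= [/IHu]; rewrite /interleave /= => ->.
by rewrite doubleS.
Qed.

Lemma all_interleave P u v : all P u -> all P v -> all P (interleave u v).
Proof.
elim: u v => [|a u IHu] [|b v] //= /andP[-> Pu] /andP[-> Pv] /=.
exact: IHu.
Qed.

Lemma block_mkseq (f : nat -> nat) o n N :
  o + n <= N -> block o n (mkseq f N) = mkseq (fun t => f (o + t)) n.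
Proof.
move=> le; apply: (@eq_from_nth _ 0).
  by rewrite size_mkseq size_takel // size_drop size_mkseq; lia.
move=> t; rewrite size_takel ?size_drop ?size_mkseq => [tn|]; last lia.
by rewrite nth_take // nth_drop !nth_mkseq //; lia.
Qed.

Lemma all_mkseq_w p n : all (gtn 5) (mkseq (fun t => w (p + t)) n).
Proof. by apply/allP=> a /mapP[t _ ->]; apply: w_lt5. Qed.

Lemma eq_in_mkseq (f g : nat -> nat) n :
  (forall t, t < n -> f t = g t) -> mkseq f n = mkseq g n.
Proof. by move=> fg; apply/eq_in_map => t; rewrite mem_iota; apply: fg. Qed.

(** * Synchronization, short half-flips and near half-flips *)

(** Here [uv] occurs at [i] and [vu] at [j], both halves having length [n]. *)
Definition flip n i j :=
  forall t, t < n -> w (i + t) = w (j + n + t) /\ w (i + n + t) = w (j + t).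

Lemma sync p q :
  (forall t, t < 44 -> w (p + t) = w (q + t)) -> p = q %[mod 95].
Proof.
move=> pq; apply/eqnP.
apply: (compatP sync_test (s := mkseq (fun t => w (p + t)) 44)).
- by apply/mapP; exists (p %% 95, mkseq (fun t => w (p + t)) 89);
    rewrite ?windowP //= block_mkseq.
- apply/mapP; exists (q %% 95, mkseq (fun t => w (q + t)) 89); rewrite ?windowP //=.
  by rewrite block_mkseq // (eq_in_mkseq pq).
- by rewrite size_mkseq.
exact: all_mkseq_w.
Qed.

Lemma no_short_flip n i j : 0 < n < 44 -> ~ flip n i j.
Proof.
case/andP=> n0 n44 ij.
have test : compat (fun _ _ => false) n.*2 (flip_words n) (flipped_words n).
  by apply: (allP flip_test); rewrite mem_iota; lia.
set u := mkseq (fun t => w (i + t)) n.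
set v := mkseq (fun t => w (i + n + t)) n.
(* The relation in [test] is constantly [false], so a common word yields [false] itself. *)
suff: false by [].
apply: (compatP test (x := tt) (y := tt) (s := interleave u v)).
- apply/mapP; exists (i %% 95, mkseq (fun t => w (i + t)) 89); rewrite ?windowP //=.
  rewrite !block_mkseq; try lia.
  by congr (_, interleave _ _); apply: eq_in_mkseq => t _; rewrite addnA.
- apply/mapP; exists (j %% 95, mkseq (fun t => w (j + t)) 89); rewrite ?windowP //=.
  rewrite !block_mkseq; try lia.
  congr (_, interleave _ _); apply: eq_in_mkseq => t /ij[].
    by rewrite addnA.
  by [].
- by rewrite size_interleave ?size_mkseq.
by apply: all_interleave; apply: all_mkseq_w.
Qed.

(** Starting at [t = 1] leaves out the offsets 0, [k] and [k.*2], where the images are cut one level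
    up. *)
Definition near_flip k i j :=
  forall t, 0 < t < k -> w (i + t) = w (j + k + t) /\ w (i + k + t) = w (j + t).

Definition triple k i := (w i, w (i + k), w (i + k.*2)).

Lemma ends_mkseq k i :
  k <= 44 -> ends k (mkseq (fun t => w (i + t)) 89) = triple k i.
Proof.
by move=> k44; rewrite /ends !nth_mkseq //; try lia; rewrite addn0.
Qed.

Lemma short_near_flip k i j :
  0 < k <= 44 -> near_flip k i j -> untwisted (triple k i) (triple k j).
Proof.
case/andP=> k0 k44 ij.
have test : compat untwisted k.-1.*2 (near_flip_words k) (near_flipped_words k).
  by apply: (allP near_flip_test); rewrite mem_iota; lia.
set u := mkseq (fun t => w (i + 1 + t)) k.-1.
set v := mkseq (fun t => w (i + k.+1 + t)) k.-1.
apply: (compatP test (s := interleave u v)).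
- apply/mapP; exists (i %% 95, mkseq (fun t => w (i + t)) 89); rewrite ?windowP //.
  cbn [snd]; rewrite ends_mkseq // !block_mkseq; try lia.
  by congr (_, interleave _ _); apply: eq_in_mkseq => t _; rewrite addnA.
- apply/mapP; exists (j %% 95, mkseq (fun t => w (j + t)) 89); rewrite ?windowP //.
  cbn [snd]; rewrite ends_mkseq // !block_mkseq; try lia.
  congr (_, interleave _ _); apply: eq_in_mkseq => t tk.
    have [|e _] := ij t.+1; first lia.
    by have -> : i + 1 + t = i + t.+1; [lia | rewrite e; congr w; lia].
  have [|_ e] := ij t.+1; first lia.
  by have -> : i + k.+1 + t = i + k + t.+1; [lia | rewrite e; congr w; lia].
- by rewrite size_interleave ?size_mkseq.
by apply: all_interleave; apply: all_mkseq_w.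
Qed.

(** All six positions are congruent mod 95, so [column_test] covers their letters. *)
Lemma same_column k i j :
  k = 0 %[mod 95] -> i = j %[mod 95] -> untwisted (triple k i) (triple k j).
Proof.
rewrite mod0n => k0 ij.
have r95 := ltn_pmod i (isT : 0 < 95).
set s := column (i %% 95).
have test : all (fun x => all (untwisted x) (triples s)) (triples s).
  by apply: (allP column_test); rewrite mem_iota.
have col p : p = i %[mod 95] -> w p \in s.
  move=> pi; rewrite mem_undup; apply/mapP; exists (img (w (p %/ 95))).
    by rewrite mem_nth // w_lt5.
  by apply: w_block => //; rewrite -pi mulnC -divn_eq.
have tri p : p = i %[mod 95] -> triple k p \in triples s.
  move=> pi; apply/allpairsP; exists ((w p, w (p + k)), w (p + k.*2)); split=> //.
    by apply/allpairsP; exists (w p, w (p + k)); split=> //; apply: col; lia.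
  by apply: col; lia.
by apply: (allP (allP test _ (tri i _))) => //; apply: tri.
Qed.

Lemma near_flip_untwisted k i j :
  0 < k -> near_flip k i j -> untwisted (triple k i) (triple k j).
Proof.
move=> k0 ij; case: (leqP k 44) => k44; first by apply: short_near_flip; rewrite ?k0.
(* Each half keeps [k.-1 >= 44] letters, enough for [sync]. *)
have s1 : i.+1 = j + k.+1 %[mod 95].
  apply: sync => t t44; have [|e _] := ij t.+1; first lia.
  by have -> : i.+1 + t = i + t.+1; [lia | rewrite e; congr w; lia].
have s2 : i + k.+1 = j.+1 %[mod 95].
  apply: sync => t t44; have [|_ e] := ij t.+1; first lia.
  by have -> : i + k.+1 + t = i + k + t.+1; [lia | rewrite e; congr w; lia].
by apply: same_column; lia.
Qed.

(** * Images of letters cut at a position *)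

Lemma eq_drop_img r p q :
  (forall s, r <= s < 95 -> w (95 * p + s) = w (95 * q + s)) ->
  drop r (img (w p)) = drop r (img (w q)).
Proof.
move=> pq; have [sp sq] := (size_img (w_lt5 p), size_img (w_lt5 q)).
apply: (@eq_from_nth _ 0); rewrite !size_drop sp ?sq // => s s95.
have rs95 : r + s < 95 by lia.
rewrite !nth_drop -(w_block rs95 (erefl _)) -(w_block rs95 (erefl _)).
by apply: pq; lia.
Qed.

Lemma eq_take_img r p q :
  r <= 95 -> (forall s, s < r -> w (95 * p + s) = w (95 * q + s)) ->
  take r (img (w p)) = take r (img (w q)).
Proof.
move=> r95 pq; have [sp sq] := (size_img (w_lt5 p), size_img (w_lt5 q)).
apply: (@eq_from_nth _ 0); rewrite !size_takel ?sp ?sq // => s sr.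
have s95 : s < 95 by lia.
rewrite !nth_take // -(w_block s95 (erefl _)) -(w_block s95 (erefl _)).
exact: pq.
Qed.

Lemma img_inj a b : a < 5 -> b < 5 -> img a = img b -> a = b.
Proof. by case: a => [|[|[|[|[|a]]]]] // _; case: b => [|[|[|[|[|b]]]]]. Qed.

Lemma mem_letter_pairs p q : (w p, w q) \in letter_pairs.
Proof. by apply: allpairs_f; rewrite mem_iota w_lt5. Qed.

Variant cut_spec r : Prop :=
  | CutSuffix of (forall p q, drop r (img (w p)) = drop r (img (w q)) -> w p = w q)
  | CutPrefix of (forall p q, take r (img (w p)) = take r (img (w q)) -> w p = w q)
  | CutTwins e of
      (forall p q, drop r (img (w p)) = drop r (img (w q)) -> suffix_twins e (w p) (w q))
    & (forall p q, take r (img (w p)) = take r (img (w q)) -> prefix_twins e (w p) (w q)).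

Lemma cutP r : 0 < r < 95 -> cut_spec r.
Proof.
move=> r95; have : cut_test r by apply: (allP cut_testT); rewrite mem_iota; lia.
have pairs := mem_letter_pairs.
case/or3P=> /allP h;
  [apply: CutSuffix | apply: CutPrefix | apply: (CutTwins (e := r <= 67))]
  => p q /eqP pq.
- by have := h _ (pairs p q); rewrite pq => /eqP.
- by have := h _ (pairs p q); rewrite pq => /eqP.
- by have := h _ (pairs p q); rewrite pq => /andP[].
by have := h _ (pairs p q); rewrite pq => /andP[].
Qed.

(** * Descent to shorter half-flips *)

(** Synchronizing both halves gives [2 * n = 0] mod 95, and 95 is odd. *)
Lemma flip_sync n i j :
  44 <= n -> flip n i j -> n = 0 %[mod 95] /\ i = j %[mod 95].
Proof.
move=> n44 ij.
have s1 : i = j + n %[mod 95].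
  by apply: sync => t t44; have [|] := ij t; first lia.
have s2 : i + n = j %[mod 95].
  by apply: sync => t t44; have [|] := ij t; first lia.
by split; lia.
Qed.

Lemma flip_blocks k r i j : flip (95 * k) (95 * i + r) (95 * j + r) ->
  forall p s, r <= 95 * p + s < 95 * k + r ->
    w (95 * (i + p) + s) = w (95 * (j + k + p) + s) /\
    w (95 * (i + k + p) + s) = w (95 * (j + p) + s).
Proof.
move=> ij p s ps; have [|e1 e2] := ij (95 * p + s - r); first lia.
split; [move: e1 | move: e2] => e.
  by transitivity (w (95 * i + r + (95 * p + s - r))); [|rewrite e]; congr w; lia.
transitivity (w (95 * i + r + 95 * k + (95 * p + s - r))); first by congr w; lia.
by rewrite e; congr w; lia.
Qed.

Lemma flip_desubstitute k r i j :
  0 < k -> r < 95 -> flip (95 * k) (95 * i + r) (95 * j + r) ->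
  exists i' j', flip k i' j'.
Proof.
move=> k0 r95 /flip_blocks ij.
(* These images lie wholly inside a half, so they determine their letters. *)
have inner p : (r <= 95 * p) -> p < k ->
    w (i + p) = w (j + k + p) /\ w (i + k + p) = w (j + p).
  move=> rp pk; split; apply: img_inj; rewrite ?w_lt5 //.
    rewrite -[LHS]drop0 -[RHS]drop0; apply: eq_drop_img => s s95.
    by have [|] := ij p s; first lia.
  rewrite -[LHS]drop0 -[RHS]drop0; apply: eq_drop_img => s s95.
  by have [|] := ij p s; first lia.
case: (posnP r) => [r0 | r0].
  by exists i, j => p pk; apply: inner => //; lia.
have near : near_flip k i j by move=> p pk; apply: inner; lia.
(* The middle image is cut in two: its prefix ends the first half and its suffix starts the second.
   Hence four comparisons. *)
have sfx1 : drop r (img (w i)) = drop r (img (w (j + k))).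
  apply: eq_drop_img => s s95; have [|] := ij 0 s; first lia.
  by rewrite !addn0.
have sfx2 : drop r (img (w (i + k))) = drop r (img (w j)).
  apply: eq_drop_img => s s95; have [|_] := ij 0 s; first lia.
  by rewrite !addn0.
have pfx1 : take r (img (w (i + k))) = take r (img (w (j + k.*2))).
  apply: eq_take_img => [|s sr]; first lia.
  have [|] := ij k s; first lia.
  by rewrite -addnn addnA.
have pfx2 : take r (img (w (i + k.*2))) = take r (img (w (j + k))).
  apply: eq_take_img => [|s sr]; first lia.
  have [|_] := ij k s; first lia.
  by rewrite -addnn addnA.
(* Of the [2k + 1] letters, [flip_left] discards the last and [flip_right] the first. *)
have flip_left : w i = w (j + k) -> w (i + k) = w j -> flip k i j.
  move=> e1 e2 [|p] pk; first by rewrite !addn0.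
  by apply: near.
have flip_right : w (i + k) = w (j + k.*2) -> w (i + k.*2) = w (j + k) ->
    flip k i.+1 j.+1.
  move=> e1 e2 p pk; rewrite !addSn -!addnS.
  case: (ltnP p.+1 k) => pk'; first exact: near.
  have -> : p.+1 = k by lia.
  by rewrite -!addnA addnn.
have /cutP[inj | inj | e sfx pfx] : 0 < r < 95 by rewrite r0.
- by exists i, j; apply: flip_left; apply: inj.
- by exists i.+1, j.+1; apply: flip_right; apply: inj.
have := near_flip_untwisted k0 near.
have : untwisted (triple k i) (triple k j) -> ~~ twisted e (triple k i) (triple k j).
  by case/andP; case: (e).
move=> /[apply]; rewrite /twisted /triple.
rewrite (sfx _ _ sfx1) (sfx _ _ sfx2) (pfx _ _ pfx1) (pfx _ _ pfx2) /=.
rewrite negb_and !negbK => /orP[] /andP[/eqnP e1 /eqnP e2].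
  by exists i, j; apply: flip_left.
by exists i.+1, j.+1; apply: flip_right.
Qed.

(** Infinite descent: from [n >= 44] to [n %/ 95], which is positive because [n] is a nonzero
    multiple of 95. *)
Lemma no_flip n i j : 0 < n -> ~ flip n i j.
Proof.
elim/ltn_ind: n i j => n IHn i j n0 ij.
case: (ltnP n 44) => n44; first by apply: (no_short_flip _ ij); rewrite n0.
have [n95 ij95] := flip_sync n44 ij.
have en : n = 95 * (n %/ 95) by lia.
have ei : i = 95 * (i %/ 95) + i %% 95 by rewrite mulnC -divn_eq.
have ej : j = 95 * (j %/ 95) + i %% 95 by rewrite ij95 mulnC -divn_eq.
rewrite en ei ej in ij.
have k0 : 0 < n %/ 95 by lia.
have [i' [j' ij']] := flip_desubstitute k0 (ltn_pmod i (isT : 0 < 95)) ij.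
by apply: IHn k0 ij'; lia.
Qed.

Lemma half_flip_flip :
  contains_half_flip (omega_word m 0%letter) -> exists n i j, 0 < n /\ flip n i j.
Proof.
case=> u [v] [u0 _ uv [i fi] [j fj]]; exists (size u), i, j.
split; first by case: (u) u0.
have get t s x : t < size s -> s = mkseq (fun l => omega_word m 0%letter (x + l)) (size s) ->
    w (x + t) = nth 0%letter s t :> nat.
  by move=> ts ->; rewrite nth_mkseq.
have su : size (u ++ v) = size u + size u by rewrite size_cat uv.
have sv : size (v ++ u) = size u + size u by rewrite size_cat uv.
move=> t tu; rewrite -!addnA; split.
  rewrite (get _ _ _ _ fi) ?(get _ _ _ _ fj) ?su ?sv; try lia.
  by rewrite !nth_cat -uv tu ltnNge leq_addr /= addKn.
rewrite (get _ _ _ _ fi) ?(get _ _ _ _ fj) ?su ?sv; try lia.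
by rewrite !nth_cat -uv tu ltnNge leq_addr /= addKn.
Qed.

Theorem mainTheorem2 : ~ contains_half_flip (omega_word m 0%letter).
Proof. by case/half_flip_flip=> n [i [j [n0 ij]]]; apply: (no_flip n0 ij). Qed.
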